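(* Let $0<T\le+\infty$ and $p\ge 1$. Let $a,b\in C[0,T)$ be nonnegative, nondecreasing functions, let $l\in C(0,T)\cap L^{1}_{Loc}[0,T)$ be a nonnegative function, and let $\omega\in C[0,+\infty)$ be a nondecreasing, nonnegative function. Assume that $u$ is a continuous and nonnegative function on $[0,T)$ with $$u(t)\le a(t)+b(t)\left(\int_{0}^{t}l(s)\,\omega(u(s))\,ds\right)^{\frac1p},\qquad t\in[0,T).$$ Then $$u(t)\le 2^{1-\frac1p}\left(\Omega^{-1}\left(\Omega(a^{p}(t))+b^{p}(t)\int_{0}^{t}l(s)\,ds\right)\right)^{\frac1p},\qquad t\in[0,T_{1}],$$ where $\mu(t)=\omega\big(2^{1-\frac1p}t^{\frac1p}\big)$, $\Omega(x)=\int_{1}^{x}\frac{1}{\mu(t)}\,dt$, $\Omega^{-1}$ is the inverse of $\Omega$, and $T_{1}\in(0,T)$ is such that $\Omega(a^{p}(t))+b^{p}(t)\int_{0}^{t}l(s)\,ds\in\mathrm{Dom}(\Omega^{-1})$ for all $t\in[0,T_{1}]$.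
   Context: $L^{1}_{Loc}[0,T)$ denotes the functions that are integrable on $[0,T']$ for every $0<T'<T$. $\mathrm{Dom}(\Omega^{-1})$ is the domain of the inverse function $\Omega^{-1}$, i.e. the range of $\Omega$. $a^p(t)$ means $(a(t))^p$, and similarly for $b^p(t)$. *)

(* Defs.v *)
From HB Require Import structures.
From mathcomp Require Import all_boot all_order all_algebra.
From mathcomp Require Import all_classical all_reals all_analysis.

Set Implicit Arguments.
Unset Strict Implicit.
Unset Printing Implicit Defensive.

Import Order.TTheory GRing.Theory Num.Theory.
Import numFieldNormedType.Exports.

Local Open Scope classical_set_scope.
Local Open Scope ring_scope.

(* [0, T) and (0, T) as sets of reals; T may be +oo. *)
Definition ico0 (R : realType) (T : \bar R) : set R :=
  [set t | 0 <= t /\ (t%:E < T)%E].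

Definition ioo0 (R : realType) (T : \bar R) : set R :=
  [set t | 0 < t /\ (t%:E < T)%E].

Definition L1loc0 (R : realType) (T : \bar R) (f : R -> R) : Prop :=
  forall T' : R, 0 < T' -> (T'%:E < T)%E ->
    (@lebesgue_measure R).-integrable `[0, T'] (EFin \o f).

Definition nonneg_on (R : realType) (D : set R) (f : R -> R) : Prop :=
  forall t, D t -> 0 <= f t.

Definition nondecr_on (R : realType) (D : set R) (f : R -> R) : Prop :=
  forall s t, D s -> D t -> s <= t -> f s <= f t.

Definition mu (R : realType) (p : R) (omega : R -> R) (t : R) : R :=
  omega (2 `^ (1 - p^-1) * t `^ p^-1).

(* The oriented integral of 1 / mu from 1 to x. The inverse is taken in \bar R,
   where 0^-1 = +oo (in R it would be 0): the integral of 1 / mu diverges over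
   any interval of positive length on which mu vanishes. *)
Definition OmegaE (R : realType) (p : R) (omega : R -> R) (x : R) : \bar R :=
  if 1 <= x
  then (\int[@lebesgue_measure R]_(t in `[1%R, x]) ((mu p omega t)%:E)^-1)%E
  else (- \int[@lebesgue_measure R]_(t in `[x, 1%R]) ((mu p omega t)%:E)^-1)%E.

(* Omega is a real-valued function on the x >= 0 where that integral converges;
   [fine] is only meaningful there. *)
Definition dom_Omega (R : realType) (p : R) (omega : R -> R) : set R :=
  [set x | 0 <= x /\ OmegaE p omega x \is a fin_num].

Definition Omega (R : realType) (p : R) (omega : R -> R) (x : R) : R :=
  fine (OmegaE p omega x).

Definition dom_Omega_inv (R : realType) (p : R) (omega : R -> R) : set R :=
  Omega p omega @` dom_Omega p omega.

Definition Omega_inv (R : realType) (p : R) (omega : R -> R) : R -> R :=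
  pinv (dom_Omega p omega) (Omega p omega).

(* Main.v *)
(* Fix t0 and put A = a(t0)^p, B = b(t0)^p, z(t) = A + B int_0^t l omega(u).
   The power mean inequality gives u <= 2^(1-1/p) z^(1/p) on [0, t0], hence
   omega(u) <= mu(z), and since z and mu are nondecreasing,
     z(t) - z(s) <= mu(z(t)) (B int_s^t l)   for s <= t.
   Dividing by mu(z(t)) and summing over a partition into levels of z bounds the
   lower sums of 1 / mu on [A, z(t0)] by B int_0^(t0) l. No differentiation of z
   or Omega is needed, and zeros of mu are harmless since 1 / mu = +oo there is
   excluded by the same inequality. *)
Require Import Defs.
From HB Require Import structures.
From mathcomp Require Import all_boot all_order all_algebra.
From mathcomp Require Import all_classical all_reals all_analysis.
From mathcomp Require Import measurable_realfun.
From mathcomp Require Import ring lra.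

Set Implicit Arguments.
Unset Strict Implicit.
Unset Printing Implicit Defensive.

Import Order.TTheory GRing.Theory Num.Theory.
Import numFieldNormedType.Exports.

Local Open Scope classical_set_scope.
Local Open Scope ring_scope.

(** * Monotonicity and measurability of [mu] and [1 / mu] *)

(** Precomposing [f] with [Num.max 0] gives a function that is nondecreasing on the whole line and
    agrees with [f] on [D]. *)
Lemma measurable_nondecreasing_ge0 (R : realType) (D : set R) (f : R -> R) :
  measurable D -> D `<=` `[0, +oo[ -> nondecr_on `[0, +oo[ f ->
  measurable_fun D f.
Proof.
move=> mD D0 f_nd.
apply: (@eq_measurable_fun _ _ _ _ D (fun x => f (Num.max 0 x))) => [x|].
  by move=> /set_mem/D0; rewrite /= in_itv/= andbT => x0; rewrite max_r.
apply: nondecreasing_measurable => // x y xy.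
by apply: f_nd; rewrite /= ?in_itv/= ?andbT ?le_max2// le_max lexx.
Qed.

Lemma mu_nondecr (R : realType) (p : R) (omega : R -> R) : 0 < p ->
  nondecr_on `[0, +oo[ omega -> nondecr_on `[0, +oo[ (mu p omega).
Proof.
move=> p0 omega_nd s t; rewrite /= !in_itv/= !andbT => s0 t0 st.
apply: omega_nd; rewrite /= ?in_itv/= ?andbT ?mulr_ge0 ?powR_ge0//.
by rewrite ler_wpM2l ?powR_ge0// ge0_ler_powR ?nnegrE ?invr_ge0// ltW.
Qed.

Lemma mu_ge0 (R : realType) (p : R) (omega : R -> R) (x : R) :
  nonneg_on `[0, +oo[ omega -> 0 <= mu p omega x.
Proof.
by move=> omega0; apply: omega0; rewrite /= in_itv/= andbT mulr_ge0 ?powR_ge0.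
Qed.

Lemma measurable_inve_mu (R : realType) (p : R) (omega : R -> R) (D : set R) :
  0 < p -> nondecr_on `[0, +oo[ omega -> nonneg_on `[0, +oo[ omega ->
  measurable D -> D `<=` `[0, +oo[ ->
  measurable_fun D (fun x => ((mu p omega x)%:E^-1)%E).
Proof.
move=> p0 omega_nd omega0 mD D0.
have mmu : measurable_fun D (mu p omega).
  by apply: measurable_nondecreasing_ge0 => //; exact: mu_nondecr.
(* The extended inverse is [+oo] on the zero set of [mu] and the real inverse elsewhere; both pieces
   are measurable. *)
under eq_fun do rewrite inver.
apply: measurable_fun_if => //.
  exact: measurable_fun_eqr.
apply: (measurable_funS mD) => //.
apply/measurable_EFinP.
apply: (@eq_measurable_fun _ _ _ _ D (fun x => mu p omega x `^ (-1))) => [x _|].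
  by rewrite powR_inv1// mu_ge0.
exact: (measurableT_comp (measurable_powR _) mmu).
Qed.

(** * Integrals over adjacent intervals and comparison with increments *)

Lemma ge0_integral_itvcc_split (R : realType) (f : R -> \bar R) (x y z : R) :
  x <= y -> y <= z -> measurable_fun `[x, z] f ->
  (forall s, x <= s -> (0 <= f s)%E) ->
  (\int[@lebesgue_measure R]_(s in `[x, z]) f s =
   \int[@lebesgue_measure R]_(s in `[x, y]) f s +
   \int[@lebesgue_measure R]_(s in `[y, z]) f s)%E.
Proof.
move=> xy yz mf f0.
have eqU := @itv_bndbnd_setU _ _ (BLeft x) (BRight y) (BRight z) xy yz.
rewrite eqU ge0_integral_setU//.
- rewrite integral_itv_obnd_cbnd//; apply: measurable_funS mf => //.
  by rewrite eqU; exact: subsetUr.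
- by rewrite -eqU.
- by rewrite -eqU => s /=; rewrite in_itv/= => /andP[xs _]; exact: f0.
- apply/disj_setPS => s [] /=; rewrite !in_itv/= => /andP[_ sy] /andP[ys _].
  by move: (lt_le_trans ys sy); rewrite ltxx.
Qed.

(* On a uniform grid the integral of [f] over a cell is at most the increment of
   [V] over the previous cell, so no value of [f] at [x], where it may blow up,
   is used; the first cell is then exhausted by monotone convergence. *)
Lemma integral_le_increments (R : realType) (f : R -> \bar R) (V : R -> R)
    (x y : R) : x < y ->
  measurable_fun `]x, y] f ->
  (forall s, x < s -> (0 <= f s)%E) ->
  (forall s t, x < s -> s <= t -> (f t <= f s)%E) ->
  (forall s t, x <= s -> s <= t -> t <= y -> ((t - s)%:E * f t <= (V t - V s)%:E)%E) ->
  (\int[@lebesgue_measure R]_(s in `]x, y]) f s <= (V y - V x)%:E)%E.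
Proof.
move=> xy mf f0 f_ni fV.
have V_nd s t : x <= s -> s < t -> t <= y -> V s <= V t.
  move=> xs st ty; rewrite -subr_ge0 -lee_fin (le_trans _ (fV _ _ xs (ltW st) ty))//.
  by rewrite mule_ge0 ?lee_fin ?subr_ge0 ?(ltW st)// f0// (le_lt_trans xs).
pose d n := (y - x) / n.+1%:R.
have d_gt0 n : 0 < d n by rewrite divr_gt0 ?subr_gt0.
have dn n : x + n.+1%:R * d n = y.
  by rewrite /d mulrC divfK ?pnatr_eq0// subrKC.
have mono n k : (k <= n)%N -> x + k.+1%:R * d n <= y.
  by move=> kn; rewrite -(dn n) lerD2l ler_pM2r// ler_nat.
(* Induction on the number of cells: cells 2 to [k + 1] are charged to the increments of [V] over
   cells 1 to [k]. *)
have step n k : (k <= n)%N ->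
    (\int[@lebesgue_measure R]_(s in `](x + d n)%R, (x + k.+1%:R * d n)%R]) f s
     <= (V (x + k%:R * d n) - V x)%:E)%E.
  elim: k => [_|k IH kn].
    rewrite mul1r set_itv_ge ?bnd_simp ?ltxx// integral_set0.
    by rewrite mul0r addr0 subrr.
  have e1 : x + d n <= x + k.+1%:R * d n.
    by rewrite lerD2l ler_peMl ?ler1n// ltW.
  have e2 : x + k.+1%:R * d n < x + k.+2%:R * d n.
    by rewrite ltrD2l ltr_pM2r// ltr_nat.
  have xk : x < x + k.+1%:R * d n by rewrite ltrDl mulr_gt0.
  have xdn : x < x + d n by rewrite ltrDl.
  have eqU := @itv_bndbnd_setU _ _ (BRight (x + d n))
     (BRight (x + k.+1%:R * d n)) (BRight (x + k.+2%:R * d n)) e1 (ltW e2).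
  have sub : `](x + d n), (x + k.+2%:R * d n)] `<=` `]x, y].
    move=> s /=; rewrite !in_itv/= => /andP[/(lt_trans xdn) -> /=].
    by move=> /le_trans; apply; exact: mono.
  rewrite eqU ge0_integral_setU//; last first.
  - apply/disj_setPS => s [] /=; rewrite !in_itv/= => /andP[_ sy] /andP[ys _].
    by move: (lt_le_trans ys sy); rewrite ltxx.
  - rewrite -eqU => s /sub /=; rewrite in_itv/= => /andP[xs _]; exact: f0.
  - by rewrite -eqU; apply: measurable_funS mf.
  have -> : V (x + k.+1%:R * d n) - V x = (V (x + k%:R * d n) - V x) +
      (V (x + k.+1%:R * d n) - V (x + k%:R * d n)) by ring.
  rewrite EFinD leeD ?IH ?(ltnW kn)//.
  (* On the new cell [f] is at most its value at the left end, which is the right end of the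
     previous cell; [fV] on that previous cell, of the same length, bounds the product. *)
  apply: (@le_trans _ _ (\int[@lebesgue_measure R]_(s in `](x + k.+1%:R * d n)%R, (x + k.+2%:R * d n)%R])
      cst (f (x + k.+1%:R * d n)%R) s)%E).
    apply: ge0_le_integral => //.
    - move=> s /=; rewrite in_itv/= => /andP[ks _]; apply: f0.
      exact: lt_trans ks.
    - apply: measurable_funS mf => //; apply: subset_trans sub.
      by rewrite eqU; exact: subsetUr.
    - move=> s /=; rewrite in_itv/= => /andP[ks _]; apply: f_ni => //.
      exact: ltW.
  rewrite integral_cst//= lebesgue_measure_itv/= lte_fin e2 muleC.
  have := fV (x + k%:R * d n) (x + k.+1%:R * d n).
  rewrite lerDl mulr_ge0 ?(ltW (d_gt0 _))// lerD2l ler_pM2r// ler_nat leqnSn.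
  move=> /(_ isT isT (mono _ _ (ltnW kn))).
  have -> // : x + k.+1%:R * d n - (x + k%:R * d n) =
      x + k.+2%:R * d n - (x + k.+1%:R * d n) by rewrite -!natr1; ring.
pose F n : set R := `]x + d n, y]%classic.
have d_ni : {homo d : n m / (n <= m)%N >-> m <= n}.
  by move=> n m nm; rewrite ler_pM2l ?subr_gt0// lef_pV2 ?posrE// ler_nat.
have bigF : \bigcup_i F i = `]x, y]%classic.
  apply/seteqP; split => s.
    move=> [n _]; rewrite /F /= !in_itv/= => /andP[+ ->].
    by rewrite andbT; apply: lt_trans; rewrite ltrDl.
  rewrite /= in_itv/= => /andP[xs sy].
  (* This choice of [n] makes the first cell shorter than [s - x], so that [s] lies beyond it. *)
  have [n nP] : exists n : nat, (y - x) / (s - x) < n.+1%:R.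
    exists (Num.bound ((y - x) / (s - x))).
    have := archi_boundP (divr_ge0 (ltW (_ : 0 < y - x)) (ltW (_ : 0 < s - x))).
    rewrite !subr_gt0 => /(_ xy xs)/lt_le_trans; apply.
    by rewrite ler_nat.
  exists n => //; rewrite /F /= in_itv/= sy andbT -ltrBrDl /d.
  by rewrite ltr_pdivrMr// mulrC -ltr_pdivrMr// subr_gt0.
have subF n : F n `<=` `]x, y] by rewrite -bigF; exact: bigcup_sup.
have F_nd : {homo F : n m / (n <= m)%N >-> (n <= m)%O}.
  move=> n m nm; apply/subsetPset => s; rewrite /F /= !in_itv/= => /andP[+ ->].
  by rewrite andbT; apply: le_lt_trans; rewrite lerD2l d_ni.
have mfF n : measurable_fun (F n) f by exact: measurable_funS mf.
have fF0 n s : F n s -> (0 <= f s)%E.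
  by move=> /subF /=; rewrite in_itv/= => /andP[+ _]; exact: f0.
have cvgF : (\int[@lebesgue_measure R]_(s in F i) f s)%E @[i --> \oo] -->
    (\int[@lebesgue_measure R]_(s in \bigcup_i F i) f s)%E.
  by apply: ge0_nondecreasing_set_cvg_integral => // n; exact: measurable_itv.
rewrite -bigF -(cvg_lim _ cvgF)//.
apply: lime_le; first by apply/cvg_ex; eexists; exact: cvgF.
near=> n.
(* For [k = n] the last cell ends at [y], and [step] gives the increment of [V] up to the grid point
   before [y]. *)
rewrite /F -[in X in (X <= _)%E](dn n).
rewrite (le_trans (step _ _ (leqnn _)))// lee_fin lerD2r.
apply: V_nd => //; first by rewrite lerDl mulr_ge0// ltW.
by rewrite -[ltRHS](dn n) ltrD2l ltr_pM2r// ltr_nat.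
Unshelve. all: by end_near. Qed.

(** * Strict monotonicity of [Omega] and its inverse *)

(** Additivity of the integral, in three cases according to the position of 1 relative to [x] and
    [y]. Membership in [dom_Omega] makes the cancellations in [\bar R] legitimate. *)
Lemma integral_inve_mu (R : realType) (p : R) (omega : R -> R) (x y : R) :
  0 < p -> nondecr_on `[0, +oo[ omega -> nonneg_on `[0, +oo[ omega ->
  dom_Omega p omega x -> dom_Omega p omega y -> x <= y ->
  (\int[@lebesgue_measure R]_(s in `[x, y]) ((mu p omega s)%:E)^-1 =
   (Omega p omega y - Omega p omega x)%:E)%E.
Proof.
move=> p0 omega_nd omega0 [x0 fx] [y0 fy] xy.
have split u v w : 0 <= u -> u <= v -> v <= w ->
    (\int[@lebesgue_measure R]_(s in `[u, w]) ((mu p omega s)%:E)^-1 =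
     \int[@lebesgue_measure R]_(s in `[u, v]) ((mu p omega s)%:E)^-1 +
     \int[@lebesgue_measure R]_(s in `[v, w]) ((mu p omega s)%:E)^-1)%E.
  move=> u0 uv vw; apply: ge0_integral_itvcc_split => //.
    apply: measurable_inve_mu => // s /=; rewrite !in_itv/= andbT => /andP[us _].
    exact: le_trans us.
  by move=> s us; rewrite inve_ge0 lee_fin mu_ge0.
rewrite /Omega EFinB !fineK//; move: fx fy; rewrite /OmegaE.
have [x1|x1] := leP 1 x.
  rewrite (le_trans x1 xy) => fx fy.
  by rewrite (split 1 x y)// addeAC subee// add0e.
rewrite fin_numN => fx; have [y1|y1] := leP 1 y => fy.
  by rewrite oppeK (split x 1 y)// ?(ltW x1)// addeC.
move: fy; rewrite fin_numN => fy.
by rewrite oppeK (split x y 1)// ?(ltW y1)// addeC addeK.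
Qed.

(** Since [1 / mu] is nonincreasing, its integral over [[x, y]] is at least [(y - x) / mu y]. This
    is positive, as the extended inverse of a real is never 0, being [+oo] when [mu y = 0]. *)
Lemma Omega_lt (R : realType) (p : R) (omega : R -> R) :
  0 < p -> nondecr_on `[0, +oo[ omega -> nonneg_on `[0, +oo[ omega ->
  {in dom_Omega p omega &, {homo Omega p omega : x y / x < y}}.
Proof.
move=> p0 omega_nd omega0 x y /set_mem domx /set_mem domy xy.
have [[x0 _] [y0 _]] := (domx, domy).
rewrite -subr_gt0 -lte_fin -integral_inve_mu ?(ltW xy)//.
apply: (@lt_le_trans _ _ (\int[@lebesgue_measure R]_(s in `[x, y])
    cst ((mu p omega y)%:E)^-1 s)%E).
  rewrite integral_cst//= lebesgue_measure_itv/= lte_fin xy.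
  rewrite mule_gt0//; last by rewrite -EFinB lte_fin subr_gt0.
  rewrite lt_neqAle eq_sym inve_eq0/= inve_ge0 lee_fin mu_ge0//.
have sub0 : `[x, y] `<=` `[0, +oo[.
  move=> s /=; rewrite !in_itv/= andbT => /andP[xs _]; exact: le_trans xs.
apply: ge0_le_integral => //.
- by move=> s _; rewrite inve_ge0 lee_fin mu_ge0.
- exact: measurable_inve_mu.
- move=> s /= sxy; have /= := sub0 _ sxy.
  move: sxy; rewrite !in_itv/= andbT => /andP[_ sy] s0.
  rewrite lee_pV2 ?inE ?lee_fin ?mu_ge0//.
  by apply: mu_nondecr => //=; rewrite in_itv/= andbT.
Qed.

(** Strict monotonicity makes [Omega] injective on [dom_Omega], so [pinv] is a genuine left inverse
    there. *)
Lemma Omega_invK (R : realType) (p : R) (omega : R -> R) :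
  0 < p -> nondecr_on `[0, +oo[ omega -> nonneg_on `[0, +oo[ omega ->
  {in dom_Omega p omega, cancel (Omega p omega) (Omega_inv p omega)}.
Proof.
move=> p0 omega_nd omega0; apply: pinvKV => x y xD yD eqxy.
have [xy|yx|//] := ltgtP x y.
  by have := Omega_lt p0 omega_nd omega0 xD yD xy; rewrite eqxy ltxx.
by have := Omega_lt p0 omega_nd omega0 yD xD yx; rewrite eqxy ltxx.
Qed.

(** * A Bihari-type inequality without differentiation *)

(* If [y < z t0], each level [s] of [z] in [z 0, y] is attained at a time
   [tau s], so [L \o tau] dominates the increments of [Omega] on [z 0, y]; this
   stays away from levels above [y], where [Omega] could be infinite. The strict
   inequality [L (tau y) < L t0] gives the contradiction. *)
Lemma bihari (R : realType) (p : R) (omega z L : R -> R) (t0 y : R) :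
  0 < p -> nondecr_on `[0, +oo[ omega -> nonneg_on `[0, +oo[ omega ->
  0 <= t0 -> {within `[0, t0], continuous z} ->
  nondecr_on `[0, t0] z -> nondecr_on `[0, t0] L ->
  (forall s t, 0 <= s -> s <= t -> t <= t0 ->
    z t - z s <= mu p omega (z t) * (L t - L s)) ->
  dom_Omega p omega (z 0) -> dom_Omega p omega y ->
  Omega p omega y = Omega p omega (z 0) + (L t0 - L 0) ->
  z t0 <= y.
Proof.
move=> p0 omega_nd omega0 t00 z_cont z_nd L_nd z_incr domz0 domy Oy.
have in0 : 0 \in `[0, t0] by rewrite in_itv/= lexx.
have int0 : t0 \in `[0, t0] by rewrite in_itv/= lexx andbT.
have L0 : L 0 <= L t0 by apply: L_nd.
rewrite leNgt; apply/negP => yz.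
have [z00 _] := domz0.
have [y0 _] := domy.
have z0y : z 0 <= y.
  rewrite leNgt; apply/negP => /(Omega_lt p0 omega_nd omega0 (mem_set domy) (mem_set domz0)).
  by rewrite Oy gtrDl subr_lt0 ltNge L0.
(* The intermediate value theorem supplies a time for each level; 0 is a dummy value for levels
   outside the range. *)
have tauP s : exists t, s \in `[z 0, z t0] -> t \in `[0, t0] /\ z t = s.
  have [sz|] := boolP (s \in `[z 0, z t0]); last by exists 0.
  have [|t tt0 zt] := IVT t00 z_cont (v := s).
    move: sz; rewrite in_itv/= => /andP[zs sz].
    by rewrite ge_min zs/= le_max sz orbT.
  by exists t.
have [tau {}tauP] := choice tauP.
have tauz s : z 0 <= s <= z t0 -> [/\ 0 <= tau s, tau s <= t0 & z (tau s) = s].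
  by move=> sz; have := tauP s; rewrite in_itv/= sz in_itv/= => /(_ isT)[/andP[]].
have tau_nd s t : z 0 <= s -> s < t -> t <= z t0 -> tau s <= tau t.
  move=> zs st tz.
  have [|s1 s2 s3] := tauz s; first by rewrite zs (le_trans (ltW st)).
  have [|t1 t2 t3] := tauz t; first by rewrite tz (le_trans zs (ltW st)).
  rewrite leNgt; apply/negP => ts.
  have : z (tau t) <= z (tau s).
    by apply: z_nd; rewrite /= ?in_itv/= ?s1 ?s2 ?t1 ?t2// ltW.
  by rewrite s3 t3 leNgt st.
have incr s t : z 0 <= s -> s < t -> t <= z t0 ->
    t - s <= mu p omega t * (L (tau t) - L (tau s)).
  move=> zs st tz.
  have [|s1 s2 s3] := tauz s; first by rewrite zs (le_trans (ltW st)).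
  have [|t1 t2 t3] := tauz t; first by rewrite tz (le_trans zs (ltW st)).
  have := z_incr _ _ s1 (tau_nd _ _ zs st tz) t2.
  by rewrite s3 t3.
have LtauE s : z 0 <= s <= z t0 -> L 0 <= L (tau s) <= L t0.
  move=> /tauz[s1 s2 _]; apply/andP; split; apply: L_nd => //=;
  by rewrite in_itv/= s1 s2.
(* Between [tau y] and [t0] the increment [z t0 - y] is positive and at most a product with
   [mu (z t0) >= 0], so both factors are positive. *)
have ytau : L (tau y) < L t0.
  have := z_incr (tau y) t0.
  have [|t1 t2 ->] := tauz y; first by rewrite z0y ltW.
  move=> /(_ t1 t2 (lexx _)) zy.
  have prod_gt0 : 0 < mu p omega (z t0) * (L t0 - L (tau y)).
    by rewrite (lt_le_trans _ zy)// subr_gt0.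
  have mu_gt0 : 0 < mu p omega (z t0).
    rewrite lt_neqAle mu_ge0// andbT eq_sym; apply/eqP => mu_eq0.
    by move: prod_gt0; rewrite mu_eq0 mul0r ltxx.
  by move: prod_gt0; rewrite pmulr_rgt0// subr_gt0.
have : Omega p omega y - Omega p omega (z 0) <= L (tau y) - L (tau (z 0)).
  have [->|neq] := eqVneq (z 0) y; first by rewrite !subrr.
  have z0y' : z 0 < y by rewrite lt_neqAle neq.
  rewrite -lee_fin -integral_inve_mu//.
  have sub0 : `[z 0, y] `<=` `[0, +oo[.
    move=> s /=; rewrite !in_itv/= andbT => /andP[xs _]; exact: le_trans xs.
  have sub : `]z 0, y] `<=` `[z 0, y].
    by move=> s /=; rewrite !in_itv/= => /andP[/ltW -> ->].
  rewrite -integral_itv_obnd_cbnd; last first.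
    by apply: measurable_inve_mu => //; exact: subset_trans sub0.
  apply: (@integral_le_increments R _ (L \o tau)) => //.
  - by apply: measurable_inve_mu => //; exact: subset_trans sub0.
  - by move=> s _; rewrite inve_ge0 lee_fin mu_ge0.
  - move=> s t zs st; have s0 := le_trans z00 (ltW zs).
    rewrite lee_pV2 ?inE ?lee_fin ?mu_ge0//.
    by apply: mu_nondecr => //=; rewrite in_itv/= andbT// (le_trans s0).
  - move=> s t zs; rewrite le_eqVlt => /predU1P[<- _|st ty].
      by rewrite subrr mul0e subrr.
    have /= := incr _ _ zs st (le_trans ty (ltW yz)).
    (* If [mu t = 0], then [incr] would force [t <= s]; hence [1 / mu t] is finite and one may
       divide by [mu t]. *)
    have := mu_ge0 p t omega0; rewrite le_eqVlt => /predU1P[<-|mut].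
      by rewrite mul0r leNgt subr_gt0 st.
    rewrite inver gt_eqF// -EFinM lee_fin => H.
    by rewrite ler_pdivrMr// mulrC.
(* [tau (z 0)] may differ from 0 when [z] is initially constant; the bound from below by [L 0] is
   enough. *)
have /andP[L0z _] : L 0 <= L (tau (z 0)) <= L t0.
  by rewrite LtauE// lexx (le_trans z0y)// ltW.
rewrite Oy; lra.
Qed.

(** * The power mean inequality and the reduction to the Bihari-type inequality *)

Lemma add_le_powR (R : realType) (p x y : R) : 1 <= p -> 0 <= x -> 0 <= y ->
  x + y <= 2 `^ (1 - p^-1) * (x `^ p + y `^ p) `^ p^-1.
Proof.
move=> p1 x0 y0; have p0 : 0 < p by rewrite (lt_le_trans _ p1).
have half01 : 0 <= (2^-1 : R) <= 1 by lra.
have midpoint : (2^-1 * x + 2^-1 * y) `^ p <= 2^-1 * x `^ p + 2^-1 * y `^ p.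
  have := @convex_powR R p p1 (Itv01 (proj1 (andP half01)) (proj2 (andP half01))) x y.
  rewrite !inE/= !in_itv/= !andbT => /(_ x0 y0).
  rewrite convRE [X in X `^ _ <= _ -> _]convRE/= /unstable.onem.
  by have -> : 1 - 2^-1 = 2^-1 :> R by lra.
have -> : x `^ p + y `^ p = 2 * (2^-1 * x `^ p + 2^-1 * y `^ p) by field.
rewrite powRM ?addr_ge0 ?mulr_ge0 ?powR_ge0 ?invr_ge0// mulrA -powRD; last first.
  by rewrite subrK pnatr_eq0 implybT.
rewrite subrK powRr1// -[leLHS](@mulVKf _ 2)// ler_pM2l//.
rewrite mulrDr.
have -> : 2^-1 * x + 2^-1 * y = ((2^-1 * x + 2^-1 * y) `^ p) `^ p^-1.
  by rewrite -powRrM divff ?gt_eqF// powRr1// addr_ge0// mulr_ge0// invr_ge0.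
by rewrite ge0_ler_powR ?nnegrE ?invr_ge0 ?(ltW p0)// ?addr_ge0 ?mulr_ge0 ?powR_ge0 ?invr_ge0.
Qed.

Lemma Rintegral_itvccB (R : realType) (f : R -> R) (a b s t : R) :
  (@lebesgue_measure R).-integrable `[a, b] (EFin \o f) ->
  a <= s -> s <= t -> t <= b ->
  \int[@lebesgue_measure R]_(x in `[a, t]) f x -
  \int[@lebesgue_measure R]_(x in `[a, s]) f x =
  \int[@lebesgue_measure R]_(x in `]s, t]) f x.
Proof.
move=> f_int as_ st tb; apply: Rintegral_itvB; rewrite ?bnd_simp//.
apply: integrableS f_int => //; apply: subset_itvl.
by rewrite bnd_simp.
Qed.

Theorem theorem2p1 (R : realType) (T : \bar R) (p : R)
    (a b l omega u : R -> R)
    (T_gt0 : (0 < T)%E)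
    (p_ge1 : 1 <= p)
    (a_cont : {within ico0 T, continuous a})
    (a_ge0 : nonneg_on (ico0 T) a)
    (a_nondecr : nondecr_on (ico0 T) a)
    (b_cont : {within ico0 T, continuous b})
    (b_ge0 : nonneg_on (ico0 T) b)
    (b_nondecr : nondecr_on (ico0 T) b)
    (l_cont : {within ioo0 T, continuous l})
    (l_L1loc : L1loc0 T l)
    (l_ge0 : nonneg_on (ioo0 T) l)
    (omega_cont : {within `[0, +oo[, continuous omega})
    (omega_nondecr : nondecr_on `[0, +oo[ omega)
    (omega_ge0 : nonneg_on `[0, +oo[ omega)
    (u_cont : {within ico0 T, continuous u})
    (u_ge0 : nonneg_on (ico0 T) u)
    (u_le : forall t, ico0 T t ->
      u t <= a t + b t *
        (\int[@lebesgue_measure R]_(s in `[0, t]) (l s * omega (u s))) `^ p^-1)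
    (T1 : R) (T1_gt0 : 0 < T1) (T1_ltT : (T1%:E < T)%E)
    (T1_dom : forall t, 0 <= t <= T1 ->
      dom_Omega p omega (a t `^ p) /\
      dom_Omega_inv p omega
        (Omega p omega (a t `^ p)
         + b t `^ p * \int[@lebesgue_measure R]_(s in `[0, t]) l s)) :
  forall t, 0 <= t <= T1 ->
    u t <= 2 `^ (1 - p^-1) *
      (Omega_inv p omega
        (Omega p omega (a t `^ p)
         + b t `^ p * \int[@lebesgue_measure R]_(s in `[0, t]) l s)) `^ p^-1.
Proof.
have p_gt0 : 0 < p by rewrite (lt_le_trans _ p_ge1).
move=> t0 t0T1; have [dom_A [y dom_y Oy]] := T1_dom _ t0T1.
(* The value of the inverse is now the preimage [y], so it remains to prove [z t0 <= y] for the
   function [z] below. *)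
rewrite -Oy Omega_invK ?inE//.
move: (t0T1) => /andP[t00 t0le].
have icoT s : 0 <= s -> s <= T1 -> ico0 T s.
  by move=> s0 sT; split => //; rewrite (le_lt_trans _ T1_ltT)// lee_fin.
have iooT s : 0 < s -> s <= T1 -> ioo0 T s.
  by move=> s0 sT; split => //; rewrite (le_lt_trans _ T1_ltT)// lee_fin.
have sub_ico : `[0, T1] `<=` ico0 T.
  by move=> s /=; rewrite in_itv/= => /andP[]; exact: icoT.
have l_int := l_L1loc _ T1_gt0 T1_ltT.
have u_contT1 : {within `[0, T1], continuous u} by apply: continuous_subspaceW u_cont.
have u_meas : measurable_fun `[0, T1] u.
  exact: subspace_continuous_measurable_fun.
have [c _ u_max] := EVT_max (ltW T1_gt0) u_contT1.
pose g s := omega (u s).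
have g_ge0 s : 0 <= s -> s <= T1 -> 0 <= g s.
  by move=> s0 sT; apply: omega_ge0; rewrite /= in_itv/= andbT u_ge0//; exact: icoT.
have g_meas : measurable_fun `[0, T1] g.
  have omega_meas : measurable_fun (`[0%R, +oo[%classic : set R) omega.
    exact: measurable_nondecreasing_ge0.
  apply: (measurable_comp _ _ omega_meas u_meas) => //.
  move=> _ /= [s sT <-]; rewrite in_itv/= andbT.
  by apply: u_ge0; exact: sub_ico.
(* [u] attains its maximum over [[0, T1]] at [c], so monotonicity of [omega] bounds [g] by
   [omega (u c)]; then [l * g] is integrable. *)
have g_bnd : [bounded g s | s in `[0, T1]%classic].
  exists (omega (u c)); split; first exact: num_real.
  move=> M cM s /= sT; apply: le_trans (ltW cM).
  have sT' : ico0 T s by exact: sub_ico.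
  move: (sT); rewrite in_itv/= => /andP[s0 sT1].
  rewrite ger0_norm; last exact: g_ge0.
  apply: omega_nondecr; rewrite /= ?in_itv/= ?andbT; [exact: u_ge0| |exact: u_max].
  exact: le_trans (u_ge0 _ sT') (u_max _ sT).
have lg_int : (@lebesgue_measure R).-integrable `[0, T1]
    (EFin \o (fun s => l s * g s)).
  exact: (integrableMl _ l_int).
pose Phi t := \int[@lebesgue_measure R]_(s in `[0, t]) (l s * g s).
pose Lam t := \int[@lebesgue_measure R]_(s in `[0, t]) l s.
pose A := a t0 `^ p; pose B := b t0 `^ p.
have A_ge0 : 0 <= A by exact: powR_ge0.
have B_ge0 : 0 <= B by exact: powR_ge0.
have at0_ge0 : 0 <= a t0 by apply: a_ge0; exact: icoT.
have bt0_ge0 : 0 <= b t0 by apply: b_ge0; exact: icoT.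
have Phi0 : Phi 0 = 0 by rewrite /Phi set_itv1 Rintegral_set1.
have Lam0 : Lam 0 = 0 by rewrite /Lam set_itv1 Rintegral_set1.
(* Increments of [Phi] and [Lam] are integrals over []s, t]], which avoids 0, where the sign of [l]
   is unspecified. *)
have itv_oc s t x : 0 <= s -> t <= t0 -> `]s, t]%classic x -> 0 < x /\ x <= T1.
  move=> s0 tt /=; rewrite in_itv/= => /andP[sx xt].
  by rewrite (le_lt_trans s0 sx) (le_trans xt)// (le_trans tt).
have Phi_nd s t : 0 <= s -> s <= t -> t <= t0 -> Phi s <= Phi t.
  move=> s0 st tt; rewrite -subr_ge0.
  rewrite (Rintegral_itvccB lg_int)// ?(le_trans tt)//.
  apply: Rintegral_ge0 => x /(itv_oc _ _ _ s0 tt)[x0 xT].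
  by rewrite mulr_ge0 ?g_ge0 ?(ltW x0)// l_ge0//; exact: iooT.
have Lam_nd s t : 0 <= s -> s <= t -> t <= t0 -> Lam s <= Lam t.
  move=> s0 st tt; rewrite -subr_ge0.
  rewrite (Rintegral_itvccB l_int)// ?(le_trans tt)//.
  apply: Rintegral_ge0 => x /(itv_oc _ _ _ s0 tt)[x0 xT].
  by rewrite l_ge0//; exact: iooT.
pose z t := A + B * Phi t.
have z_nd s t : 0 <= s -> s <= t -> t <= t0 -> z s <= z t.
  by move=> s0 st tt; rewrite /z lerD2l ler_wpM2l// Phi_nd.
have u_le_z t : 0 <= t -> t <= t0 -> u t <= 2 `^ (1 - p^-1) * z t `^ p^-1.
  move=> t_ge0 tt; have tT1 := le_trans tt t0le.
  have Phi_ge0 : 0 <= Phi t by rewrite -Phi0 Phi_nd.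
  (* The [p]-th power of the second summand is [B * Phi t], so the sum of powers is [z t];
     monotonicity of [a] and [b] allows freezing them at [t0]. *)
  have := @add_le_powR R p (a t0) (b t0 * Phi t `^ p^-1) p_ge1 at0_ge0
    (mulr_ge0 bt0_ge0 (powR_ge0 _ _)).
  rewrite powRM ?powR_ge0// -powRrM mulVf ?gt_eqF// powRr1//.
  apply: le_trans; apply: (le_trans (u_le _ (icoT _ t_ge0 tT1))).
  rewrite lerD ?ler_wpM2r ?powR_ge0//.
    by apply: a_nondecr => //; exact: icoT.
  by apply: b_nondecr => //; exact: icoT.
have z_incr s t : 0 <= s -> s <= t -> t <= t0 ->
    z t - z s <= mu p omega (z t) * (B * Lam t - B * Lam s).
  move=> s0 st tt; have tT1 := le_trans tt t0le.
  have -> : z t - z s = B * (Phi t - Phi s) by rewrite /z; ring.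
  rewrite -mulrBr mulrCA ler_wpM2l//.
  rewrite (Rintegral_itvccB lg_int)// (Rintegral_itvccB l_int)//.
  have sub : `]s, t] `<=` `[0, T1].
    by move=> x /(itv_oc _ _ _ s0 tt)[/ltW x0 xT]; rewrite /= in_itv/= x0.
  have l_int' : (@lebesgue_measure R).-integrable `]s, t] (EFin \o l).
    exact: integrableS l_int.
  rewrite -RintegralZl//; apply: le_Rintegral => //.
  - exact: integrableS lg_int.
  - exact: (integrableZl _ _ l_int').
  move=> x xst; have [x0 xT] := itv_oc _ _ _ s0 tt xst.
  move: xst; rewrite /= in_itv/= => /andP[sx xt].
  rewrite mulrC ler_wpM2r//; first by apply: l_ge0; exact: iooT.
  have xt0 := le_trans xt tt.
  (* The chain is [omega (u x) <= mu (z x) <= mu (z t)]: first [u_le_z] under [omega], then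
     monotonicity of [z] and [mu]. *)
  apply: (@le_trans _ _ (mu p omega (z x))).
    apply: omega_nondecr; rewrite /= ?in_itv/= ?andbT ?mulr_ge0 ?powR_ge0//.
      by apply: u_ge0; exact/icoT/xT/ltW.
    by apply: u_le_z => //; exact: ltW.
  have z_ge0 w : 0 <= w -> w <= t0 -> 0 <= z w.
    by move=> w0 wt; rewrite addr_ge0// mulr_ge0// -Phi0 Phi_nd.
  apply: mu_nondecr => //=; rewrite ?in_itv/= ?andbT ?z_ge0 ?z_nd ?(ltW x0)//.
  by rewrite (le_trans s0).
have z_cont : {within `[0, t0], continuous z}.
  have Phi_cont : {within `[0, t0], continuous Phi}.
    apply: continuous_subspaceW (parameterized_integral_continuous (ltW T1_gt0) lg_int).
    by apply: subset_itvl; rewrite bnd_simp.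
  move=> x; apply: cvgD; first exact: cvg_cst.
  by apply: cvgM; [exact: cvg_cst|exact: Phi_cont].
have z0 : z 0 = A by rewrite /z Phi0 mulr0 addr0.
have zt0y : z t0 <= y.
  (* The factor [B] is absorbed into [L], which vanishes at 0, so [Oy] is exactly the required
     identity. *)
  apply: (@bihari R p omega z (fun t => B * Lam t)) => //.
  - by move=> s t /=; rewrite !in_itv/= => /andP[s0 _] /andP[_ tt] st; exact: z_nd.
  - move=> s t /=; rewrite !in_itv/= => /andP[s0 _] /andP[_ tt] st.
    by rewrite ler_wpM2l// Lam_nd.
  - by rewrite z0.
  - by rewrite z0 Lam0 mulr0 subr0 Oy.
apply: (le_trans (u_le_z _ t00 (lexx _))).
rewrite ler_wpM2l ?powR_ge0// ge0_ler_powR ?nnegrE ?invr_ge0 ?(ltW p_gt0)//.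
  by rewrite -z0 in A_ge0; rewrite (le_trans A_ge0)// z_nd.
exact: dom_y.1.
Qed.
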